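(* Let $p$ be an odd prime, and let $n\in\{3,\ldots,p\}$ and $r\in\mathbb Z$. Then $$F_p(pn-2,r)\equiv-n!\left(\frac{B_{p-n+1}(-r)}{n-1}+(r+1)\frac{B_{p-n}(-r)}n\right)\pmod p.$$
   Context: For a prime $p$, $n\in\mathbb N=\{0,1,2,\ldots\}$ and $r\in\mathbb Z$, put $C_p(n,r)=\sum_{0\le k\le n,\ k\equiv r\,(\mathrm{mod}\ p)}\binom nk(-1)^k$. The Fleck quotient is $$F_p(n,r)=(-p)^{-\lfloor(n-1)/(p-1)\rfloor}C_p(n,r)+[\![n=0]\!],$$ where $[\![A]\!]$ is $1$ if the assertion $A$ holds and $0$ otherwise; it is an integer (Fleck). The Bernoulli polynomials $B_n(t)$ are defined by $\frac{xe^{tx}}{e^x-1}=\sum_{n=0}^\infty B_n(t)\frac{x^n}{n!}$. Congruences modulo $p$ between rational numbers are understood in the ring $\mathbb Z_p$ of $p$-adic integers, i.e. $x\equiv y\pmod p$ means $x-y\in p\mathbb Z_p$. *)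

(* Defs.v *)
From HB Require Import structures.
From mathcomp Require Import all_boot all_order all_algebra.

Set Implicit Arguments.
Unset Strict Implicit.
Unset Printing Implicit Defensive.

Import Order.TTheory GRing.Theory Num.Theory.
Local Open Scope ring_scope.

Definition fleck_sum (p n : nat) (r : int) : int :=
  \sum_(0 <= k < n.+1 | (k%:Z == r %[mod p%:Z])%Z) (-1) ^+ k * 'C(n, k)%:Z.

(* The subtraction n - 1 is in int, so that the exponent is 1 for n = 0; %/ is
   the floor since p - 1 > 0. *)
Definition fleck_quotient (p n : nat) (r : int) : rat :=
  (- p%:Q) ^ (- ((n%:Z - 1) %/ (p%:Z - 1))%Z) * (fleck_sum p n r)%:Q
  + (n == 0%N)%:R.

(* Formal power series in x are represented by their coefficient sequences. *)

Definition fps_mul (R : comNzRingType) (f g : nat -> R) (n : nat) : R :=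
  \sum_(k < n.+1) f k * g (n - k)%N.

(* The first n coefficients of 1 / f, for f 0 invertible; the coefficient of
   index m is obtained from sum_(k <= m) (1 / f)_k f_(m - k) = [m = 0]. *)
Fixpoint fps_inv_seq (R : comUnitRingType) (f : nat -> R) (n : nat) : seq R :=
  if n is m.+1 then
    let s := fps_inv_seq f m in
    rcons s ((f 0%N)^-1 * ((m == 0%N)%:R - \sum_(k < m) s`_k * f (m - k)%N))
  else [::].

Definition fps_inv (R : comUnitRingType) (f : nat -> R) (n : nat) : R :=
  (fps_inv_seq f n.+1)`_n.

(* e^(a x) *)
Definition fps_exp (a : {poly rat}) (n : nat) : {poly rat} :=
  (n`!%:R)^-1 *: a ^+ n.

(* (e^x - 1) / x *)
Definition fps_expm1_div (n : nat) : {poly rat} := fps_exp 1 n.+1.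

(* The generating function x e^(tx) / (e^x - 1) is e^(tx) / ((e^x - 1) / x),
   with t the variable 'X of {poly rat}; see bernoulli_poly_gf. *)
Definition bernoulli_poly (n : nat) : {poly rat} :=
  n`!%:R *: fps_mul (fps_exp 'X) (fps_inv fps_expm1_div) n.

(* Meaningful for x != 0 only. *)
Definition padic_val (p : nat) (x : rat) : int :=
  (logn p `|numq x|)%:Z - (logn p `|denq x|)%:Z.

(* Membership of a rational in Z_p, the valuation ring of Q_p. *)
Definition padic_int (p : nat) (x : rat) : bool :=
  (x == 0) || (0 <= padic_val p x).

Definition eqmod_padic (p : nat) (x y : rat) : Prop :=
  exists2 z : rat, padic_int p z & x - y = p%:Q * z.

Lemma padic_intE (p : nat) (x : rat) :
  prime p -> padic_int p x = ~~ (p %| `|denq x|)%N.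
Proof.
move=> pr_p; rewrite /padic_int /padic_val subr_ge0 lez_nat.
have d_gt0 : (0 < `|denq x|)%N by rewrite absz_gt0 denq_neq0.
have [->|x_neq0] := eqVneq x 0.
  rewrite (_ : denq 0 = 1) //= dvdn1; by case: eqP pr_p => // ->.
have n_gt0 : (0 < `|numq x|)%N by rewrite absz_gt0 numq_eq0.
have := coprime_num_den x.
have -> : (p %| `|denq x|)%N = (0 < logn p `|denq x|)%N.
  by rewrite logn_gt0 mem_primes pr_p d_gt0.
have [pd cop|] := posnP (logn p `|denq x|); first by rewrite pd leq0n.
move=> /[dup] ld_gt0; rewrite logn_gt0 mem_primes => /and3P[_ _ pd] cop /=.
apply/negbTE; rewrite -ltnNge (leq_ltn_trans _ ld_gt0) // leqn0.
rewrite eqn0Ngt logn_gt0 mem_primes pr_p n_gt0 /=; apply/negP => pn.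
by have := prime_gt1 pr_p; have := dvdn_gcd p `|numq x| `|denq x|;
  rewrite pn pd (eqP cop) dvdn1 => /eqP ->.
Qed.

Lemma size_fps_inv_seq (R : comUnitRingType) (f : nat -> R) n :
  size (fps_inv_seq f n) = n.
Proof. by elim: n => //= n IHn; rewrite size_rcons IHn. Qed.

Lemma nth_fps_inv_seq (R : comUnitRingType) (f : nat -> R) n k :
  (k < n)%N -> (fps_inv_seq f n)`_k = fps_inv f k.
Proof.
rewrite /fps_inv; elim: n => // n IHn; rewrite ltnS leq_eqVlt.
case/predU1P=> [->//|lt_kn].
by rewrite [LHS]/= nth_rcons size_fps_inv_seq lt_kn IHn.
Qed.

Lemma fps_mulVf (R : comUnitRingType) (f : nat -> R) n :
  f 0%N \is a GRing.unit -> fps_mul (fps_inv f) f n = (n == 0%N)%:R.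
Proof.
move=> Uf; rewrite /fps_mul big_ord_recr /= subnn {2}/fps_inv /=.
rewrite nth_rcons size_fps_inv_seq ltnn eqxx mulrC mulVKr //.
rewrite addrC -[RHS](subrK (\sum_(k < n) (fps_inv_seq f n)`_k * f (n - k)%N)).
by congr (_ + _); apply: eq_bigr => k _; rewrite nth_fps_inv_seq.
Qed.

Lemma fps_mul_coef (R : comNzRingType) (f g : nat -> R) N n : (n < N)%N ->
  fps_mul f g n = ((\poly_(i < N) f i) * (\poly_(i < N) g i))`_n.
Proof.
move=> lt_nN; rewrite coefM; apply: eq_bigr => k _; rewrite !coef_poly.
by rewrite (leq_ltn_trans _ lt_nN) 1?(leq_ltn_trans (leq_subr _ _) lt_nN) ?leq_ord.
Qed.

Lemma fps_mulA (R : comNzRingType) (f g h : nat -> R) :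
  fps_mul f (fps_mul g h) =1 fps_mul (fps_mul f g) h.
Proof.
move=> n; pose T (u : nat -> R) := \poly_(i < n.+1) u i.
transitivity (T f * (T g * T h))`_n; last rewrite mulrA.
  rewrite coefM; apply: eq_bigr => k _; rewrite -fps_mul_coef ?ltnS ?leq_subr //.
  by rewrite coef_poly ltn_ord.
rewrite coefM; apply: eq_bigr => k _; rewrite -fps_mul_coef //.
by rewrite coef_poly ltnS leq_subr.
Qed.

(* (sum_n B_n(t) x^n / n!) * (e^x - 1) = x e^(tx) *)
Lemma bernoulli_poly_gf (n : nat) :
  fps_mul (fun k => (k`!%:R)^-1 *: bernoulli_poly k)
          (fun k => fps_exp 1 k - (k == 0%N)%:R) n
  = if n is m.+1 then fps_exp 'X m else 0.
Proof.
have fact_neq0 k : k`!%:R != 0 :> rat by rewrite pnatr_eq0 -lt0n fact_gt0.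
have e0 : fps_exp 1 0 - 1 = 0 by rewrite /fps_exp expr0 invr1 scale1r subrr.
case: n => [|n]; first by rewrite /fps_mul big_ord1 /= e0 mulr0.
rewrite /fps_mul big_ord_recr /= subnn e0 mulr0 addr0.
transitivity (fps_mul (fps_mul (fps_exp 'X) (fps_inv fps_expm1_div))
                      fps_expm1_div n).
  apply: eq_bigr => k _; rewrite /bernoulli_poly scalerA mulVf // scale1r.
  by rewrite subSn ?leq_ord // subr0.
rewrite -fps_mulA {1}/fps_mul big_ord_recr /= subnn fps_mulVf /=; last first.
  by rewrite /fps_expm1_div /fps_exp expr1n invr1 scale1r unitr1.
rewrite mulr1 big1 ?add0r // => k _; rewrite fps_mulVf /=; last first.
  by rewrite /fps_expm1_div /fps_exp expr1n invr1 scale1r unitr1.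
by rewrite subn_eq0 leqNgt ltn_ord mulr0.
Qed.

(* Main.v *)
Require Import Defs.
From HB Require Import structures.
From mathcomp Require Import all_boot all_order all_algebra.
From mathcomp Require Import cyclic ring lra zify.
Import Order.TTheory GRing.Theory Num.Theory.
Local Open Scope ring_scope.
Set Implicit Arguments.
Unset Strict Implicit.
Unset Printing Implicit Defensive.

(* Write (1 - X)^(p-1) = p g + (1 + X + ... + X^(p-1)) with g p-integral. Modulo
   X^p - 1 this gives (1 - X)^(pn-2) = p^n G with G = (1 - X)^(n-2) g^n, so that
   the Fleck quotient is (-1)^n times the sum of the coefficients of G at the
   exponents k = r (mod p). By Fermat the indicator of k = r (mod p) is
   1 - (k - r)^(p-1) modulo p, and G(1) = 0, so this sum is congruent to
   -(p-1)! times the coefficient of x^(p-1) in e^(-rx) G(e^x). Let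
   u = (e^x - 1)/x. Since p g(e^x) = (1 - e^x)^(p-1) - (e^(px) - 1)/(e^x - 1),
   the product u g(e^x) is -(e^(px) - 1)/(px) modulo x^(p-1), hence -1 modulo p;
   the coefficient becomes that of x^(p+1-n) in e^(-rx)/u^2, a Bernoulli
   polynomial of order 2, which reduces to ordinary Bernoulli polynomials by
   differentiating e^(tx)/u. *)

(** * Rationals integral at p *)

(* Coprimality of the denominator makes this a subring for every p; it agrees
   with padic_int when p is prime. *)
Definition pint (p : nat) : {pred rat} := fun x => coprime p `|denq x|.

(** The reduced denominator divides every d for which x * d is an integer, so integrality can be
    checked on an unreduced fraction. *)
Lemma pint_frac (p d : nat) (z : int) (x : rat) :
  (0 < d)%N -> coprime p d -> x * d%:R = z%:~R -> x \in pint p.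
Proof.
move=> d_gt0 cop xd; rewrite unfold_in /pint.
apply: (coprime_dvdr _ cop).
have : numq x * d%:Z = z * denq x.
  apply/eqP; rewrite -(eqr_int rat) !rmorphM /= -xd numqE -[d%:~R]/(d%:R).
  by apply/eqP; ring.
move/(congr1 absz); rewrite !abszM /= => H.
have : (`|denq x| %| `|numq x| * d)%N by rewrite H dvdn_mull.
by rewrite Gauss_dvdr // coprime_sym coprime_num_den.
Qed.

Lemma pint_int p (z : int) : z%:~R \in pint p.
Proof. by rewrite unfold_in /pint denq_int coprimen1. Qed.

Lemma pint_nat p (m : nat) : m%:R \in pint p.
Proof. exact: (pint_int p m). Qed.

Fact pint_subring_closed p : subring_closed (pint p).
Proof.
have dx (x : rat) : (0 < `|denq x|)%N by rewrite absz_gt0 denq_neq0.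
have nE (x : rat) : x * (`|denq x|)%:R = (numq x)%:~R.
  by rewrite numqE -[in RHS]absz_denq.
split=> [|x y Sx Sy|x y Sx Sy]; first exact: (pint_int p 1).
- apply: (@pint_frac p (`|denq x| * `|denq y|)%N
            (numq x * `|denq y|%N - numq y * `|denq x|%N)).
  + by rewrite muln_gt0 !dx.
  + by rewrite coprimeMr; apply/andP.
  + by rewrite natrM rmorphB !rmorphM /= -!nE -!pmulrn; ring.
- apply: (@pint_frac p (`|denq x| * `|denq y|)%N (numq x * numq y)).
  + by rewrite muln_gt0 !dx.
  + by rewrite coprimeMr; apply/andP.
  + by rewrite natrM rmorphM /= -!nE; ring.
Qed.

HB.instance Definition _ p :=
  GRing.isSubringClosed.Build rat (pint p) (pint_subring_closed p).

Lemma padic_int_pint p x : prime p -> padic_int p x = (x \in pint p).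
Proof. by move=> pr_p; rewrite padic_intE // unfold_in /pint prime_coprime. Qed.

Lemma pint_invf (p m : nat) : prime p -> (m < p)%N -> (m`!%:R)^-1 \in pint p.
Proof.
move=> pr_p lt_mp; apply: (@pint_frac p m`! 1); rewrite ?fact_gt0 //.
  elim: m lt_mp => [|m IHm] lt_mp; first by rewrite coprimen1.
  rewrite factS coprimeMr IHm ?(ltnW lt_mp) // andbT prime_coprime //.
  by apply/negP => /dvdn_leq; lia.
by rewrite mulVf // pnatr_eq0 -lt0n fact_gt0.
Qed.

(** * Polynomials modulo a power of the variable *)

(** With the quotient as an explicit witness, compatibility with sums and products becomes a ring
    identity. *)
Definition modXn (R : nzRingType) (N : nat) (f g : {poly R}) :=
  exists q, f = g + q * 'X^N.

Section ModXn.
Variable R : comNzRingType.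
Implicit Types f g h : {poly R}.

Lemma modXnP N f g : modXn N f g <-> (forall i, (i < N)%N -> f`_i = g`_i).
Proof.
split=> [[q ->] i lt_iN|eq_fg]; first by rewrite coefD coefMXn lt_iN addr0.
exists (drop_poly N (f - g)); rewrite -[LHS](subrKC g); congr (_ + _).
rewrite -[LHS](poly_take_drop N) (_ : take_poly N _ = 0) ?add0r //.
apply/polyP => i; rewrite coef_take_poly coef0 coefB.
by case: ifP => // /eq_fg ->; rewrite subrr.
Qed.

Lemma modXn_refl N f : modXn N f f.
Proof. by exists 0; ring. Qed.

Lemma modXn_sym N f g : modXn N f g -> modXn N g f.
Proof. by case=> q ->; exists (- q); ring. Qed.

Lemma modXn_trans N f g h : modXn N f g -> modXn N g h -> modXn N f h.
Proof. by case=> q -> [r ->]; exists (q + r); ring. Qed.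

Lemma modXnD N f g f' g' :
  modXn N f g -> modXn N f' g' -> modXn N (f + f') (g + g').
Proof. by case=> q -> [r ->]; exists (q + r); ring. Qed.

Lemma modXnM N f g f' g' :
  modXn N f g -> modXn N f' g' -> modXn N (f * f') (g * g').
Proof.
case=> q -> [r ->]; exists (q * g' + g * r + q * r * 'X^N); ring.
Qed.

Lemma modXnX N f g n : modXn N f g -> modXn N (f ^+ n) (g ^+ n).
Proof.
move=> fg; elim: n => [|n IHn]; first exact: modXn_refl.
by rewrite !exprS; apply: modXnM.
Qed.

Lemma modXn_mulX N f g : modXn N.+1 ('X * f) ('X * g) -> modXn N f g.
Proof.
move/modXnP=> fg; apply/modXnP => i lt_iN.
by have := fg i.+1 lt_iN; rewrite !coefXM.
Qed.

(** Derivation loses one order of precision; the factor ['X] restores it. *)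
Lemma modXn_Xderiv N f g : modXn N f g -> modXn N ('X * f^`()) ('X * g^`()).
Proof.
move/modXnP=> fg; apply/modXnP => i lt_iN.
rewrite !coefXM; case: i lt_iN => // i lt_iN /=.
by rewrite !coef_deriv fg.
Qed.

End ModXn.

(** * Linear functionals on polynomials *)

(** The functional with value [phi k] at ['X^k]. It serves both for indicators of residue classes
    modulo p and for powers of k + t. *)
Definition moment (phi : nat -> rat) (f : {poly rat}) : rat :=
  \sum_(k < size f) f`_k * phi k.

Lemma momentE phi (f : {poly rat}) N : (size f <= N)%N ->
  moment phi f = \sum_(k < N) f`_k * phi k.
Proof.
move=> le_fN; rewrite /moment (big_ord_widen N (fun k => f`_k * phi k)) //.
rewrite [RHS](bigID (fun k : 'I_N => k < size f)%N) /= [X in _ + X]big1 ?addr0 //.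
by move=> k; rewrite -leqNgt => ?; rewrite nth_default ?mul0r.
Qed.

Lemma momentD phi f g : moment phi (f + g) = moment phi f + moment phi g.
Proof.
pose N := maxn (size f) (size g).
rewrite !(@momentE phi _ N) ?leq_maxl ?leq_maxr ?size_polyD //.
by rewrite -big_split; apply: eq_bigr => k _; rewrite coefD mulrDl.
Qed.

Lemma momentZ phi a f : moment phi (a *: f) = a * moment phi f.
Proof.
rewrite !(@momentE phi _ (size f)) ?size_scale_leq // mulr_sumr.
by apply: eq_bigr => k _; rewrite coefZ mulrA.
Qed.

Lemma momentMXn phi f j :
  moment phi (f * 'X^j) = moment (fun k => phi (k + j)%N) f.
Proof.
rewrite (@momentE _ (f * 'X^j) (j + size f)) /moment; last first.
  by rewrite (leq_trans (size_polyMleq _ _)) // size_polyXn addnC.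
rewrite big_split_ord /= big1 ?add0r => [|i _]; last by rewrite coefMXn ltn_ord mul0r.
by apply: eq_bigr => k _; rewrite coefMXn ltnNge leq_addr /= addKn addnC.
Qed.

(** * Truncated exponential series *)

Lemma factr_neq0 (R : numDomainType) k : k`!%:R != 0 :> R.
Proof. by rewrite pnatr_eq0 -lt0n fact_gt0. Qed.

Definition texp (N : nat) (a : rat) : {poly rat} := \poly_(i < N) (a ^+ i / i`!%:R).

Lemma texpD N a b : modXn N (texp N a * texp N b) (texp N (a + b)).
Proof.
apply/modXnP => i lt_iN; rewrite coefM coef_poly lt_iN exprDn mulr_suml.
rewrite (reindex_inj rev_ord_inj) /=; apply: eq_bigr => -[j lt_ji] _ /=.
rewrite !coef_poly subSS (leq_ltn_trans (leq_subr _ _) lt_iN) subKn //.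
rewrite (leq_ltn_trans _ lt_iN) // -(@bin_fact i j) // !natrM.
have C_neq0 : 'C(i, j)%:R != 0 :> rat by rewrite pnatr_eq0 -lt0n bin_gt0.
by rewrite -mulr_natr; field; rewrite C_neq0 !factr_neq0.
Qed.

Lemma texp0 N : modXn N (texp N 0) 1.
Proof.
apply/modXnP => i lt_iN; rewrite coef_poly lt_iN coef1 expr0n.
by case: i {lt_iN} => [|i]; rewrite ?invr1 ?mulr1 ?mul0r.
Qed.

Lemma texpX N a k : modXn N (texp N a ^+ k) (texp N (a *+ k)).
Proof.
elim: k => [|k IHk]; first exact/modXn_sym/texp0.
rewrite exprS mulrS; apply: modXn_trans (texpD _ _ _).
exact/modXnM/IHk/modXn_refl.
Qed.

(** Substituting e^x for the variable turns e^(tx) f(e^x) into the sum of the f_k e^((k+t)x), the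
    exponential generating function of the power moments of f. *)
Lemma coef_texp_comp N t (f : {poly rat}) i : (i < N)%N ->
  (texp N t * (f \Po texp N 1))`_i
    = moment (fun k => (k%:R + t) ^+ i) f / i`!%:R.
Proof.
move=> lt_iN; rewrite comp_polyE mulr_sumr coef_sum /moment mulr_suml.
apply: eq_bigr => k _; rewrite -scalerAr coefZ -mulrA; congr (_ * _).
have /modXnP -> // : modXn N (texp N t * texp N 1 ^+ k) (texp N (k%:R + t)).
  rewrite addrC; apply: modXn_trans (texpD _ _ _).
  exact/modXnM/texpX/modXn_refl.
by rewrite coef_poly lt_iN.
Qed.

Lemma modXn_texp M N a : (M <= N)%N -> modXn M (texp N a) (texp M a).
Proof.
move=> le_MN; apply/modXnP => i lt_iM.
by rewrite !coef_poly lt_iM (leq_trans lt_iM).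
Qed.

Lemma deriv_texp N a : (texp N.+1 a)^`() = a *: texp N a.
Proof.
apply/polyP => i; rewrite coef_deriv coefZ !coef_poly ltnS.
case: ifP => _; last by rewrite mul0rn mulr0.
rewrite factS natrM exprS -mulr_natr; field.
by rewrite factr_neq0 nat1r pnatr_eq0.
Qed.

Lemma Xderiv_texp N t :
  modXn N ('X * (texp N t)^`()) (t *: ('X * texp N t)).
Proof.
case: N => [|N]; first exact/modXnP.
rewrite deriv_texp -scalerAr; apply/modXnP => -[|i] lt_iN; rewrite !coefZ !coefXM //=.
by rewrite ltnS in lt_iN; rewrite !coef_poly lt_iN ltnS (ltnW lt_iN).
Qed.

(** * The series u = (e^x - 1)/x, its inverse, and Bernoulli polynomials *)

(* (e^(cx) - 1) / (cx) modulo x^N *)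
Definition texpm1_div N (c : rat) : {poly rat} := \poly_(i < N) (c ^+ i / i.+1`!%:R).

Lemma texp_sub1 N c : texp N.+1 c = 1 + c *: ('X * texpm1_div N c).
Proof.
apply/polyP => i; rewrite coefD coef1 coefZ coefXM !coef_poly.
case: i => [|i] /=; first by rewrite invr1 mulr0 addr0 mulr1.
by rewrite ltnS add0r; case: ifP; rewrite ?mulr0 // exprS mulrA.
Qed.

(* The series fps_inv fps_expm1_div has constant polynomials as coefficients, so
   the value of t is irrelevant. *)
Definition binv (t : rat) k := (fps_inv fps_expm1_div k).[t].

Lemma binv_rec t n :
  \sum_(k < n.+1) binv t k / (n - k).+1`!%:R = (n == 0%N)%:R.
Proof.
have /(congr1 (horner^~ t)) : fps_mul (fps_inv fps_expm1_div) fps_expm1_div n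
    = (n == 0%N)%:R.
  apply: fps_mulVf.
  by rewrite /fps_expm1_div /fps_exp expr1n invr1 scale1r unitr1.
rewrite /fps_mul horner_sum => H.
transitivity ((n == 0%N)%:R : {poly rat}).[t]; last by case: eqP; rewrite hornerE.
rewrite -H; apply: eq_bigr => k _.
by rewrite hornerM /fps_expm1_div /fps_exp expr1n hornerZ hornerC mulr1.
Qed.

Definition tbinv N t : {poly rat} := \poly_(i < N) binv t i.

Lemma tbinvP N t : modXn N (texpm1_div N 1 * tbinv N t) 1.
Proof.
apply/modXnP => i lt_iN; rewrite mulrC coefM coef1 -(binv_rec t).
apply: eq_bigr => -[k lt_ki] _; rewrite !coef_poly /= expr1n mul1r.
by rewrite !(leq_ltn_trans _ lt_iN) ?leq_subr.
Qed.

Lemma coef_bernoulli N t m : (m < N)%N ->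
  (bernoulli_poly m).[t] = m`!%:R * (texp N t * tbinv N t)`_m.
Proof.
move=> lt_mN; rewrite /bernoulli_poly hornerZ /fps_mul horner_sum coefM.
congr (_ * _); apply: eq_bigr => -[k lt_km] _ /=.
rewrite hornerM /fps_exp hornerZ hornerXn !coef_poly.
by rewrite !(leq_ltn_trans _ lt_mN) ?leq_subr // mulrC [_^-1 * _]mulrC mulrC.
Qed.

(** Differentiating e^x = 1 + x u gives x u' = 1 + x u - u. Differentiating u w = 1 then gives x w'
    = - w^2 x u' = w - x w - w^2. *)
Lemma Xderiv_tbinv N t (w := tbinv N t) :
  modXn N ('X * w^`()) (w - 'X * w - w ^+ 2).
Proof.
set u := texpm1_div N 1.
have d1 : (1 : {poly rat})^`() = 0 by rewrite -polyC1 derivC.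
have [a uw] : modXn N (u * w) 1 := tbinvP N t.
have [b Xu'] : modXn N ('X * u^`()) (1 + 'X * u - u).
  have /(congr1 deriv) : texp N.+1 1 = 1 + 'X * u by rewrite texp_sub1 scale1r.
  rewrite deriv_texp scale1r derivD derivM derivX d1 add0r mul1r => e.
  have -> : 'X * u^`() = texp N 1 - u by rewrite e; ring.
  apply: modXnD (modXn_refl _ _).
  rewrite -[_ * u]scale1r -texp_sub1; apply/modXn_sym/modXn_texp.
  exact: leqnSn.
have [c Xuw'] : modXn N ('X * (u * w)^`()) ('X * 1^`()) := modXn_Xderiv (tbinvP N t).
rewrite d1 mulr0 derivM in Xuw'.
(* The quotients a, b, c of the three congruences, weighted as in the linear combination below. *)
exists (w * c - w ^+ 2 * b - 'X * w^`() * a - ('X * w - w) * a).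
apply/eqP; rewrite -subr_eq0; apply/eqP.
transitivity (w * ('X * (u^`() * w + u * w^`()) - (0 + c * 'X^N))
  - w ^+ 2 * ('X * u^`() - (1 + 'X * u - u + b * 'X^N))
  - ('X * w^`() + ('X * w - w)) * (u * w - (1 + a * 'X^N))); first by ring.
by rewrite Xuw' Xu' uw; ring.
Qed.

(* With f = e^(tx) / u and u = (e^x - 1) / x, one has
   e^(tx) / u^2 = f + (t - 1) x f - x f'. *)
Lemma coef_bernoulli2 N t m : (0 < m < N)%N ->
  m`!%:R * (texp N t * tbinv N t ^+ 2)`_m
    = (1 - m%:R) * (bernoulli_poly m).[t]
      + (t - 1) * (m%:R * (bernoulli_poly m.-1).[t]).
Proof.
case: m => // m /= lt_mN; set w := tbinv N t; set e := texp N t.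
pose f := e * w.
have /modXnP -> // : modXn N (e * w ^+ 2)
    (f + (t - 1) *: ('X * f) - 'X * f^`()).
  have [a Xw'] := Xderiv_tbinv N t; have [b eqe] := Xderiv_texp N t.
  exists (b * w + e * a); rewrite /f derivM.
  apply/eqP; rewrite -subr_eq0; apply/eqP.
  transitivity (w * ('X * e^`() - (t *: ('X * e) + b * 'X^N))
    + e * ('X * w^`() - (w - 'X * w - w ^+ 2 + a * 'X^N))).
    by rewrite -!mul_polyC polyCB; ring.
  by rewrite eqe Xw' !subrr !mulr0 addr0.
rewrite coefB coefD coefZ !coefXM /= coef_deriv.
rewrite !(@coef_bernoulli N) // 1?ltnW // -/e -/w -/f factS natrM -mulr_natr.
ring.
Qed.

(** * Integrality of the truncated series at p *)

(** Below p - 1 the recurrence [binv_rec] divides only by factorials of numbers less than p. At i =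
    p - 1 a denominator p appears, hence the truncation of the inverse series at order p - 1. *)
Lemma binv_pint p t i : prime p -> (i < p.-1)%N -> binv t i \in pint p.
Proof.
move=> pr_p; have [n] := ubnP i; elim: n i => // n IHn i lt_in lt_ip.
have := binv_rec t i; rewrite big_ord_recr /= subnn invr1 mulr1 => /(canRL (addKr _)) ->.
rewrite rpredD ?rpred_nat // rpredN rpred_sum // => k _.
have lt_ki := ltn_ord k.
by rewrite rpredM ?IHn ?pint_invf //; lia.
Qed.

Lemma tbinv_pint p t : prime p -> tbinv p.-1 t \is a polyOver (pint p).
Proof.
move=> pr_p; apply/polyOverP => i; rewrite coef_poly.
by case: ifP => [lt_i|_]; rewrite ?rpred0 ?binv_pint.
Qed.

Lemma texp_pint p N (r : int) : prime p -> (N <= p)%N ->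
  texp N r%:~R \is a polyOver (pint p).
Proof.
move=> pr_p le_Np; apply/polyOverP => i; rewrite coef_poly.
case: ifP => [lt_i|_]; rewrite ?rpred0 // rpredM ?rpredX ?rpred_int //.
by rewrite pint_invf // (leq_trans lt_i).
Qed.

(** * Congruences modulo p *)

(** For p prime this is [eqmod_padic], by [padic_int_pint]. *)
Definition cong (p : nat) (x y : rat) := exists2 z, z \in pint p & x - y = p%:R * z.

Lemma cong_refl p x : cong p x x.
Proof. by exists 0; rewrite ?rpred0 // mulr0 subrr. Qed.

Lemma cong_trans p x y z : cong p x y -> cong p y z -> cong p x z.
Proof.
by case=> a Sa xy [b Sb yz]; exists (a + b); rewrite ?rpredD // mulrDr -xy -yz; ring.
Qed.

Lemma congD p x y x' y' : cong p x y -> cong p x' y' -> cong p (x + x') (y + y').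
Proof.
by case=> a Sa xy [b Sb yz]; exists (a + b); rewrite ?rpredD // mulrDr -xy -yz; ring.
Qed.

Lemma congMl p a x y : a \in pint p -> cong p x y -> cong p (a * x) (a * y).
Proof. by move=> Sa [b Sb e]; exists (a * b); rewrite ?rpredM // mulrCA -e mulrBr. Qed.

Lemma congMr p a x y : a \in pint p -> cong p x y -> cong p (x * a) (y * a).
Proof. by move=> Sa; rewrite ![_ * a]mulrC; exact: congMl. Qed.

Lemma cong_sum p (I : Type) (s : seq I) (F G : I -> rat) :
  (forall i, cong p (F i) (G i)) -> cong p (\sum_(i <- s) F i) (\sum_(i <- s) G i).
Proof.
by move=> FG; elim/big_ind2: _ => *; [exact: cong_refl | exact: congD | exact: FG].
Qed.

Lemma cong_int (p : nat) (a b : int) : (a = b %[mod p])%Z -> cong p a%:~R b%:~R.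
Proof.
move/eqP; rewrite eqz_mod_dvd => /dvdzP[c abc].
by exists c%:~R; rewrite ?pint_int // -rmorphB /= abc rmorphM /= mulrC.
Qed.

Lemma cong_moment p phi psi (f : {poly rat}) : f \is a polyOver (pint p) ->
  (forall k, cong p (phi k) (psi k)) -> cong p (moment phi f) (moment psi f).
Proof.
move=> Sf phi_psi; apply: cong_sum => k.
by apply: congMl (phi_psi k); apply: (polyOverP Sf).
Qed.

Lemma fermat_indicator p (z : int) : prime p -> odd p ->
  cong p ((p%:Z %| z)%Z%:R) (1 - z%:~R ^+ p.-1).
Proof.
move=> pr_p odd_p; have p_gt1 := prime_gt1 pr_p.
(* As p - 1 is even, the sign of z disappears and Euler's theorem on natural numbers applies. *)
have ev : (z%:~R ^+ p.-1 : rat) = ((`|z|%N ^ p.-1)%N%:Z)%:~R.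
  rewrite -abszX abszE ger0_norm ?rmorphXn //.
  by rewrite exprn_even_ge0 // -oddS prednK ?prime_gt0.
rewrite ev; case: (boolP (_ %| _)%Z) => [pz|npz].
  have [w Sw e] : cong p ((`|z|%N ^ p.-1)%N%:Z)%:~R 0%:~R.
    apply: cong_int; apply/eqP; rewrite eqz_mod_dvd subr0 dvdzE /=.
    by rewrite dvdn_exp //; lia.
  by exists w => //; rewrite -e /=; ring.
have [w Sw e] : cong p ((`|z|%N ^ p.-1)%N%:Z)%:~R 1%:~R.
  apply: cong_int; rewrite modz_nat -[1 in RHS]/(Posz 1) modz_nat; congr Posz.
  rewrite -totient_prime //.
  by apply: Euler_exp_totient; rewrite coprime_sym prime_coprime // -[p]/(`|p%:Z|%N) -dvdzE.
by exists w => //; rewrite -e /=; ring.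
Qed.

(** * Fleck sums as moments *)

Lemma coef_1subX_exp (R : comNzRingType) N k :
  ((1 - 'X : {poly R}) ^+ N)`_k = (-1) ^+ k *+ 'C(N, k).
Proof.
have -> : (1 - 'X) ^+ N = \poly_(i < N.+1) ((-1) ^+ i *+ 'C(N, i)) :> {poly R}.
  rewrite exprBn poly_def; apply: eq_bigr => i _.
  by rewrite expr1n mulr1 -mul_polyC rmorphMn rmorphXn rmorphN1 mulrnAl.
rewrite coef_poly ltnS; case: ltnP => // lt_Nk.
by rewrite bin_small.
Qed.

Lemma fleck_sum_moment p N (r : int) :
  (fleck_sum p N r)%:Q
    = moment (fun k => (p%:Z %| k%:Z - r)%Z%:R) ((1 - 'X) ^+ N).
Proof.
rewrite (@momentE _ _ N.+1); last first.
  apply/leq_sizeP => k lt_Nk; rewrite coef_1subX_exp bin_small //.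
rewrite /fleck_sum rmorph_sum big_mkcond big_mkord; apply: eq_bigr => k _.
rewrite coef_1subX_exp eqz_mod_dvd; case: ifP => _; rewrite ?mulr0 // mulr1.
by rewrite rmorphM rmorphXn rmorphN rmorph1 /= -mulr_natr.
Qed.

(** A p-periodic [phi] gives ['X^(k + p)] and ['X^k] the same value, so its moment depends only on
    the class modulo ['X^p - 1]. *)
Lemma moment_periodic p phi h : (forall k, phi (k + p)%N = phi k) ->
  moment phi (h * ('X^p - 1)) = 0.
Proof.
move=> phi_per; rewrite mulrBr mulr1 momentD -scaleN1r momentZ momentMXn.
rewrite mulN1r /moment; under eq_bigr do rewrite phi_per.
by rewrite subrr.
Qed.

(** * Extraction of the power of p *)

(* ((1 - X)^(p-1) - (1 + X + ... + X^(p-1))) / p, whose value at a nontrivial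
   p-th root of unity zeta is the unit (1 - zeta)^(p-1) / p. *)
Definition fleck_unit p : {poly rat} :=
  \poly_(k < p) (((-1) ^+ k *+ 'C(p.-1, k) - 1) / p%:R).

Lemma fleck_unitP p : prime p ->
  (1 - 'X) ^+ p.-1 = p%:R *: fleck_unit p + \sum_(i < p) 'X^i.
Proof.
move=> pr_p; have p_gt0 := prime_gt0 pr_p.
have -> : \sum_(i < p) 'X^i = \poly_(i < p) (1 : rat).
  by rewrite poly_def; apply: eq_bigr => i _; rewrite scale1r.
apply/polyP => k; rewrite coef_1subX_exp coefD coefZ !coef_poly.
case: ltnP => le_pk; last by rewrite bin_small ?mulr0 ?addr0 //; lia.
rewrite mulrCA divff ?pnatr_eq0 -?lt0n // mulr1; ring.
Qed.

(** As p divides C(p, k+1) = C(p-1, k+1) + C(p-1, k), each step in k changes the sign of C(p-1, k)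
    modulo p, so (-1)^k C(p-1, k) stays congruent to 1. *)
Lemma fleck_unit_pint p : prime p -> fleck_unit p \is a polyOver (pint p).
Proof.
move=> pr_p; have p_gt0 := prime_gt0 pr_p.
have p_neq0 : p%:R != 0 :> rat by rewrite pnatr_eq0 -lt0n.
apply/polyOverP => k; rewrite coef_poly; case: ifP => [lt_kp|_]; last exact: rpred0.
suff [z Sz ->] : cong p ((-1) ^+ k *+ 'C(p.-1, k)) 1 by rewrite mulrAC divff // mul1r.
elim: k lt_kp => [_|k IHk lt_kp]; first by rewrite bin0; exact: cong_refl.
have [z Sz e] := IHk (ltnW lt_kp).
have /dvdnP[c ec] : (p %| 'C(p, k.+1))%N by rewrite prime_dvd_bin.
have : 'C(p, k.+1) = ('C(p.-1, k.+1) + 'C(p.-1, k))%N.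
  by rewrite -[in LHS](prednK p_gt0) binS.
rewrite ec => /(congr1 (fun m => m%:R : rat)); rewrite natrM natrD => ec'.
exists ((-1) ^+ k.+1 * c%:R + z).
  by rewrite rpredD // rpredM ?rpredX ?rpredN ?rpred1 ?rpred_nat.
rewrite mulrDr -e mulrCA [p%:R * _]mulrC ec' exprS; ring.
Qed.

(** Expanding (p g + Phi)^n leaves p^n g^n plus a multiple of Phi. One factor 1 - X, available since
    n - 2 > 0, turns Phi into 1 - X^p, which periodicity kills. *)
Lemma moment_1subX p n phi : prime p -> (3 <= n)%N ->
  (forall k, phi (k + p)%N = phi k) ->
  moment phi ((1 - 'X) ^+ (p * n - 2))
    = p%:R ^+ n * moment phi ((1 - 'X) ^+ (n - 2) * fleck_unit p ^+ n).
Proof.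
move=> pr_p n_ge3 phi_per; have p_gt1 := prime_gt1 pr_p.
set g := fleck_unit p; set Phi : {poly rat} := \sum_(i < p) 'X^i.
have -> : (p * n - 2 = (n - 2) + p.-1 * n)%N by nia.
rewrite exprD exprM (fleck_unitP pr_p) -/g -/Phi.
have -> : (p%:R *: g + Phi) ^+ n = (p%:R *: g) ^+ n
    + Phi * \sum_(i < n) (p%:R *: g + Phi) ^+ (n.-1 - i) * (p%:R *: g) ^+ i.
  apply/eqP; rewrite [eqbRHS]addrC -subr_eq subrXX.
  by rewrite [p%:R *: g + Phi - _]addrAC subrr add0r.
set Q := \sum_(i < n) _.
have -> : (n - 2 = (n - 3).+1)%N by lia.
rewrite mulrDr momentD exprZn -scalerAr momentZ -[RHS]addr0; congr (_ + _).
rewrite -(moment_periodic (- ((1 - 'X) ^+ (n - 3) * Q)) phi_per) subrX1 -/Phi exprS.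
by congr moment; ring.
Qed.

Lemma fleck_quotientE p n r : prime p -> odd p -> (3 <= n)%N -> (n <= p)%N ->
  fleck_quotient p (p * n - 2) r
    = (-1) ^+ n * moment (fun k => (p%:Z %| k%:Z - r)%Z%:R)
                    ((1 - 'X) ^+ (n - 2) * fleck_unit p ^+ n).
Proof.
move=> pr_p odd_p n_ge3 le_np.
have p_neq0 : p%:R != 0 :> rat by rewrite pnatr_eq0; lia.
rewrite /fleck_quotient fleck_sum_moment moment_1subX //; last first.
  by move=> k; rewrite -!eqz_mod_dvd PoszD modzDr.
have -> : (p * n - 2 == 0)%N = false by nia.
have -> : (((p * n - 2)%N%:Z - 1) %/ (p%:Z - 1))%Z = n.
  (* The remainder n - 3 lies in [0, p - 1), so the floor is n. *)
  have -> : (p * n - 2)%N%:Z - 1 = n%:Z * (p%:Z - 1) + (n - 3)%N%:Z.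
    by rewrite -!subzn; [rewrite PoszM; ring|lia|nia].
  rewrite divzMDl; last by lia.
  by rewrite divz_small ?addr0 //; lia.
rewrite addr0 mulrA; congr (_ * _).
rewrite -exprnN -exprVn -exprMn; congr (_ ^+ _).
by rewrite -[p%:Q]/(p%:R); field.
Qed.

(** * The integral factor at e^x, and its power moments *)

(** For 0 < i < p - 1 the coefficient p^i / (i+1)! is divisible by p, since (i+1)! is prime to p.
    The series is thus 1 modulo p, and so are its powers. *)
Lemma texpm1_div_cong1 p n : prime p ->
  exists2 f, f \is a polyOver (pint p)
    & texpm1_div p.-1 p%:R ^+ n = 1 + p%:R *: f.
Proof.
move=> pr_p; have p_gt1 := prime_gt1 pr_p.
elim: n => [|n [f Sf e]]; first by exists 0; rewrite ?rpred0 // scaler0 addr0.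
(* This is the series minus 1, divided by p. *)
pose h : {poly rat} := \poly_(i < p.-1) (if i is j.+1 then p%:R ^+ j / i.+1`!%:R else 0).
have Sh : h \is a polyOver (pint p).
  apply/polyOverP => -[|i]; rewrite coef_poly; case: ifP => lt_i; rewrite ?rpred0 //.
  by rewrite rpredM ?rpredX ?rpred_nat // pint_invf //; lia.
have vE : texpm1_div p.-1 p%:R = 1 + p%:R *: h.
  apply/polyP => -[|i]; rewrite coefD coef1 coefZ !coef_poly.
    by case: ifP => lt_i; [rewrite invr1 mulr0 addr0 mulr1 | lia].
  by rewrite add0r; case: ifP; rewrite ?mulr0 // exprS mulrA.
exists (h + f + p%:R *: (h * f)).
  by rewrite !rpredD // polyOverZ ?rpred_nat ?rpredM.
by rewrite exprS e vE -!mul_polyC; ring.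
Qed.

(** Multiplying [fleck_unitP] by X - 1 turns its sum into X^p - 1. At X = e^x the left side has
    order at least p, so p x u g = - (e^(px) - 1) = - p x v modulo x^p; cancelling x costs one order
    of precision. *)
Lemma fleck_unit_texp p : prime p ->
  modXn p.-1 (texpm1_div p.-1 1 * (fleck_unit p \Po texp p 1)) (- texpm1_div p.-1 p%:R).
Proof.
move=> pr_p; have p_gt1 := prime_gt1 pr_p.
have p_neq0 : p%:R != 0 :> rat by rewrite pnatr_eq0; lia.
set u := texpm1_div p.-1 1; set v := texpm1_div p.-1 p%:R.
set g := fleck_unit p \Po _.
have pE : p.-1.+1 = p by rewrite prednK //; lia.
have uE : texp p 1 = 1 + 'X * u by rewrite -[in LHS]pE texp_sub1 scale1r.
have vE : texp p p%:R = 1 + p%:R *: ('X * v) by rewrite -[X in texp X _]pE texp_sub1.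
have [a Ep] : modXn p (texp p 1 ^+ p) (texp p p%:R) := texpX p 1 p.
have := congr1 (fun f => f \Po texp p 1) (fleck_unitP pr_p).
rewrite rmorphXn rmorphB /= comp_polyC comp_polyX comp_polyD comp_polyZ -/g.
rewrite raddf_sum /=.
under eq_bigr do rewrite rmorphXn /= comp_polyX.
move/(congr1 (fun f => (texp p 1 - 1) * f)); rewrite mulrDr -subrX1 Ep vE uE => H.
apply: modXn_mulX; rewrite pE.
suff [q e] : modXn p (p%:R *: ('X * (u * g))) (p%:R *: ('X * - v)).
  exists (p%:R^-1 *: q); apply: (scalerI p_neq0).
  by rewrite e scalerDr -scalerAl scalerA mulfV // scale1r.
(* The term - a is the truncation error of e^(px); the other comes from (x u) (- x u)^(p-1). *)
exists (- a + (-1) ^+ p.-1 * u ^+ p).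
have Xp : 'X^p = 'X * 'X^(p.-1) :> {poly rat} by rewrite -exprS pE.
have up : u ^+ p = u * u ^+ p.-1 :> {poly rat} by rewrite -exprS pE.
transitivity ((1 + 'X * u - 1) * (1 - (1 + 'X * u)) ^+ p.-1
              - (1 + p%:R *: ('X * v) + a * 'X^p - 1)).
  by rewrite H addrK -!mul_polyC; ring.
have -> : 1 - (1 + 'X * u) = -1 * ('X * u) by ring.
by rewrite 2!exprMn Xp up -!mul_polyC; ring.
Qed.

(** In e^(tx) G(e^x) the factor (1 - e^x)^(n-2) = (- x u)^(n-2) shifts the index p - 1 to p + 1 - n.
    What remains is u^(n-2) g^n = (u g)^n / u^2 with u g = - v, and the signs cancel. *)
Lemma moment_pow p n t : prime p -> (3 <= n)%N -> (n <= p)%N ->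
  moment (fun k => (k%:R + t) ^+ p.-1) ((1 - 'X) ^+ (n - 2) * fleck_unit p ^+ n)
    = p.-1`!%:R * (texp p.-1 t * (texpm1_div p.-1 p%:R ^+ n * tbinv p.-1 t ^+ 2))`_(p.+1 - n).
Proof.
move=> pr_p n_ge3 le_np; have p_gt1 := prime_gt1 pr_p.
have nE : n = (n - 2 + 2)%N by lia.
set G := _ * _; apply: (canRL (mulVKf (factr_neq0 rat p.-1))).
have := @coef_texp_comp p t G p.-1.
rewrite prednK ?prime_gt0 // leqnn => /(_ isT).
rewrite [RHS]mulrC => <-.
set u := texpm1_div p.-1 1; set v := texpm1_div p.-1 _; set w := tbinv _ _.
set g := fleck_unit p \Po texp p 1.
have uE : texp p 1 = 1 + 'X * u.
  by rewrite -[in LHS](prednK (prime_gt0 pr_p)) texp_sub1 scale1r.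
have -> : G \Po texp p 1 = (-1) ^+ (n - 2) *: (u ^+ (n - 2) * g ^+ n) * 'X^(n - 2).
  rewrite rmorphM !rmorphXn rmorphB /= comp_polyC comp_polyX -/g uE polyC1.
  have -> : 1 - (1 + 'X * u) = -1 * ('X * u) by ring.
  by rewrite 2!exprMn -!mul_polyC rmorphXn rmorphN1; ring.
rewrite mulrA coefMXn; case: ltnP => [|le_n]; first by lia.
have -> : (p.-1 - (n - 2) = p.+1 - n)%N by lia.
(* Precision p - 1 suffices: p + 1 - n < p - 1 because n is at least 3. *)
have /modXnP -> // : modXn p.-1
    (texp p t * ((-1) ^+ (n - 2) *: (u ^+ (n - 2) * g ^+ n)))
    (texp p.-1 t * (v ^+ n * w ^+ 2)); last by lia.
apply: modXnM; first exact/modXn_texp/leq_pred.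
have ug : modXn p.-1 (u * g) (- v) := fleck_unit_texp pr_p.
have uw : modXn p.-1 (u * w) 1 := tbinvP p.-1 t.
(* Inserting (u w)^2, which is 1, completes u^(n-2) to u^n. *)
apply: (@modXn_trans _ _ _ ((-1) ^+ n *: ((u * g) ^+ n * w ^+ 2))).
  have sE : (-1) ^+ (n - 2) = (-1) ^+ n :> rat.
    by rewrite {2}nE exprD sqrrN expr1n mulr1.
  have -> : (u * g) ^+ n * w ^+ 2 = (u ^+ (n - 2) * g ^+ n) * (u * w) ^+ 2.
    by rewrite !exprMn {1}nE exprD; ring.
  rewrite sE -!mul_polyC; apply: modXnM; first exact: modXn_refl.
  rewrite -[X in modXn _ X _]mulr1; apply: modXnM; first exact: modXn_refl.
  by rewrite -[X in modXn _ X _](expr1n _ 2); apply/modXn_sym/modXnX.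
have -> : v ^+ n * w ^+ 2 = (-1) ^+ n *: ((- v) ^+ n * w ^+ 2).
  by rewrite scalerAl -mul_polyC rmorphXn rmorphN1 -exprMn mulN1r opprK.
rewrite -!mul_polyC; apply: modXnM; first exact: modXn_refl.
by apply: modXnM; [exact: modXnX | exact: modXn_refl].
Qed.

(** * The final congruence *)

(** The factors p - 1, ..., p - k are -1, ..., -k modulo p. *)
Lemma cong_ffact p k : (k < p)%N -> cong p (p.-1 ^_ k)%:R ((-1) ^+ k * k`!%:R).
Proof.
elim: k => [|k IHk] lt_kp; first by rewrite mul1r; exact: cong_refl.
rewrite ffactnSr natrM; have := congMr (pint_nat p (p.-1 - k)) (IHk (ltnW lt_kp)).
move/cong_trans; apply; exists ((-1) ^+ k * k`!%:R).
  by rewrite rpredM ?rpredX ?rpredN ?rpred1 ?rpred_nat.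
have -> : (p.-1 - k = p - k.+1)%N by lia.
rewrite factS natrM natrB ?(ltnW lt_kp) // exprS; ring.
Qed.

Theorem corollary1p6 (p n : nat) (r : int) (p_prime : prime p) (p_odd : odd p)
    (n_ge3 : (3 <= n)%N) (n_le_p : (n <= p)%N) :
  eqmod_padic p
    (fleck_quotient p (p * n - 2)%N r)
    (- n`!%:Q * ((bernoulli_poly (p - n + 1)%N).[- r%:Q] / (n%:Q - 1)
                 + (r%:Q + 1) * ((bernoulli_poly (p - n)%N).[- r%:Q] / n%:Q))).
Proof.
set t := - r%:Q; set m := (p - n + 1)%N.
have p_gt1 := prime_gt1 p_prime.
have tE : t = (- r)%:~R by rewrite rmorphN.
have m_bounds : (0 < m < p.-1)%N by rewrite /m; lia.
(* Denominators are cleared exactly, by n! = n (n-1) (n-2)!. *)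
suff [z Sz e] : cong p (fleck_quotient p (p * n - 2)%N r)
    (- (n - 2)`!%:R * (n%:R * (bernoulli_poly m).[t]
       + (r%:~R + 1) * ((n%:R - 1) * (bernoulli_poly (p - n)).[t]))).
  exists z; first by rewrite padic_int_pint.
  rewrite -[p%:Q]/(p%:R) -e; congr (_ - _).
  have [k ->] : exists k, n = k.+2 by exists (n - 2)%N; lia.
  rewrite -[k.+2`!%:Q]/(k.+2`!%:R) -[k.+2%:Q]/(k.+2%:R) subSS subSS subn0 2!factS.
  rewrite !natrM -[k.+2%:R]natr1 -[k.+1%:R]natr1; field.
  have k_ge0 := ler0n rat k.
  by apply/andP; split; rewrite gt_eqF //; lra.
set G := (1 - 'X) ^+ (n - 2) * fleck_unit p ^+ n.
have SG : G \is a polyOver (pint p).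
  rewrite rpredM ?rpredX ?fleck_unit_pint //.
  by rewrite rpredB ?rpred1 ?polyOverX.
have S1 k : (-1) ^+ k \in pint p by rewrite rpredX ?rpredN ?rpred1.
rewrite fleck_quotientE // -/G.
set e2 := texp p.-1 t * tbinv p.-1 t ^+ 2.
have Se2 : e2 \is a polyOver (pint p).
  by rewrite rpredM ?rpredX ?tbinv_pint // tE texp_pint // leq_pred.
have mom_cong : cong p (moment (fun k => (p%:Z %| k%:Z - r)%Z%:R) G)
    (- (p.-1`!%:R * e2`_m)).
  apply: (@cong_trans _ _ (moment (fun k => 1 - (k%:R + t) ^+ p.-1) G)).
    apply: cong_moment => // k.
    have := fermat_indicator (k%:Z - r) p_prime p_odd.
    by rewrite rmorphB.
  (* The constant 1 contributes G(1), which vanishes because 1 - X divides G. *)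
  have -> : moment (fun k => 1 - (k%:R + t) ^+ p.-1) G
      = - moment (fun k => (k%:R + t) ^+ p.-1) G.
    have G1 : \sum_(k < size G) G`_k = 0.
      have : G.[1] = 0.
        by rewrite hornerM horner_exp !hornerE subrr expr0n subn_eq0 leqNgt n_ge3 mul0r.
      by rewrite horner_coef; under eq_bigr do rewrite expr1n mulr1.
    rewrite /moment; under eq_bigr do rewrite mulrBr mulr1.
    by rewrite big_split /= G1 add0r sumrN.
  rewrite moment_pow // -!mulNr.
  apply: congMl; first by rewrite rpredN rpred_nat.
  have -> : (p.+1 - n = m)%N by rewrite /m; lia.
  have [f Sf ->] := texpm1_div_cong1 n p_prime.
  exists (texp p.-1 t * (f * tbinv p.-1 t ^+ 2))`_m.
    apply/polyOverP; rewrite !rpredM ?rpredX ?tbinv_pint // tE texp_pint //.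
    exact: leq_pred.
  rewrite -coefB -coefZ; congr ((polyseq _)`_m); rewrite /e2 -!mul_polyC; ring.
apply: cong_trans (congMl (S1 n) mom_cong) _.
have SB k : (k < p.-1)%N -> (bernoulli_poly k).[t] \in pint p.
  move=> lt_k; rewrite (coef_bernoulli t lt_k) rpredM ?rpred_nat //.
  by apply/polyOverP; rewrite rpredM ?tbinv_pint // tE texp_pint ?leq_pred.
have := coef_bernoulli2 t m_bounds; rewrite -/e2.
have -> : m.-1 = (p - n)%N by rewrite /m; lia.
move=> m_e2.
(* [coef_bernoulli2] absorbs m!, and [cong_ffact] reduces the cofactor (p-1)!/m! to (-1)^(n-2)
   (n-2)!. *)
have -> : p.-1`!%:R = (p.-1 ^_ (n - 2))%:R * m`!%:R :> rat.
  rewrite -natrM -(@ffact_fact p.-1 (n - 2)); last by lia.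
  by congr (_ * _`!)%:R; rewrite /m; lia.
have -> : (-1) ^+ n * - ((p.-1 ^_ (n - 2))%:R * m`!%:R * e2`_m)
    = (p.-1 ^_ (n - 2))%:R * ((-1) ^+ n * - (m`!%:R * e2`_m)) by ring.
have Sm : m`!%:R * e2`_m \in pint p.
  by rewrite rpredM ?rpred_nat //; apply/polyOverP.
have lt_n2 : (n - 2 < p)%N by lia.
apply: cong_trans (congMr _ (cong_ffact lt_n2)) _.
  by rewrite rpredM ?rpredN.
have -> : (-1) ^+ (n - 2) * (n - 2)`!%:R * ((-1) ^+ n * - (m`!%:R * e2`_m))
    = - (n - 2)`!%:R * (m`!%:R * e2`_m).
  have nE : n = (n - 2 + 2)%N by lia.
  rewrite [X in (-1) ^+ X * - _]nE exprD.
  have := sqrr_sign rat (n - 2); rewrite expr2 => s2.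
  transitivity (((-1) ^+ (n - 2) * (-1) ^+ (n - 2)) * (- (n - 2)`!%:R * (m`!%:R * e2`_m)) : rat).
    by ring.
  by rewrite s2 mul1r.
apply: congMl; first by rewrite rpredN rpred_nat.
rewrite m_e2 /t.
set b1 := (bernoulli_poly m).[_]; set b0 := (bernoulli_poly _).[_].
(* Here 1 - m = n - p, m = p - (n - 1) and t - 1 = - (r + 1); the witness collects the multiples of
   p. Both Bernoulli values are integral at p since m < p - 1. *)
exists (- b1 + (t - 1) * b0).
  rewrite rpredD ?rpredN ?SB //; first by lia.
  by rewrite rpredM ?rpredB ?rpred1 ?SB // ?tE ?rpred_int //; lia.
have -> : m%:R = p%:R + 1 - n%:R :> rat by rewrite natrD natrB // addrAC.
rewrite -[r%:~R]opprK -/t; ring.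
Qed.
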